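(* Let $\mathcal{M}$ be an arbitrary variety of groups and $\mathcal{A}$ the variety of abelian groups. (1) Let $G\in\mathcal{M}$ be a countable group such that the abelianization $G_{ab}$ is a free abelian group. Then $G$ embeds in some $2$-generated group $H\in\mathcal{M}\mathcal{A}$. In particular, every finitely generated group $G\in\mathcal{M}$ such that the abelianization $G_{ab}$ is torsion-free embeds in some $2$-generated group $H\in\mathcal{M}\mathcal{A}$. (2) Let $G$ be a countable solvable group of derived length $l$ such that the abelianization $G_{ab}$ is a free abelian group. Then $G$ embeds in some $2$-generated solvable group $H$ of derived length $l+1$. In particular, every finitely generated solvable group $G$ of derived length $l$ such that the abelianization $G_{ab}$ is torsion-free embeds in some $2$-generated solvable group $H$ of derived length $l+1$. (3) Every finitely generated group $G\in\mathcal{M}$ has a subgroup $K$ of finite index that can be embedded in some $2$-generated group $H\in\mathcal{M}\mathcal{A}$. In particular, every finitely generated solvable group $G$ of derived length $l$ has a subgroup $K$ of finite index that can be embedded in some $2$-generated solvable group $H$ of derived length $l+1$.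
   Context: Countable means finite or countably infinite. $G_{ab}=G/G'$, where $G'$ is the derived subgroup of $G$. A group is $k$-generated if it can be generated by $k$ elements (not necessarily distinct). For varieties of groups $\mathcal{M}$ and $\mathcal{N}$, the product variety $\mathcal{M}\mathcal{N}$ consists of all groups $H$ having a normal subgroup $N\in\mathcal{M}$ with $H/N\in\mathcal{N}$. *)

(* Defs.v *)
From HB Require Import structures.
From mathcomp Require Import all_boot.
From mathcomp Require Import ssralg ssrint.
From mathcomp Require Import boolp classical_sets functions cardinality.

Set Implicit Arguments.
Unset Strict Implicit.
Unset Printing Implicit Defensive.

Local Open Scope group_scope.
Local Open Scope classical_set_scope.
Local Open Scope quotient_scope.

(* Groups are arbitrary (possibly infinite) [groupType]s and subgroups are
   [groupClosed] predicates; every subset of [G] gives a boolean predicate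
   through [asbool], so these are all the subgroups.                          *)

HB.mixin Record isConjClosed (G : groupType) (S : {pred G}) := {
  gpredJ : forall x y : G, x \in S -> x ^ y \in S
}.

#[short(type="normalClosed")]
HB.structure Definition NormalClosed (G : groupType) :=
  {S of GroupClosed G S & isConjClosed G S}.

Section SubgroupType.
Variables (G : groupType) (S : groupClosed G).

Definition subgroup_type := {x : G | x \in S}.

HB.instance Definition _ := SubChoice.on subgroup_type.

Fact subgroup_type_closed : group_closed S.
Proof. by split=> [|x y]; [exact: gpred1 | exact: gpredF]. Qed.

HB.instance Definition _ :=
  SubChoice_isSubGroup.Build G (fun x => x \in S) subgroup_type
    subgroup_type_closed.
End SubgroupType.

Section QuotientGroup.
Variables (G : groupType) (N : normalClosed G).

Definition coset_eq (x y : G) : bool := x^-1 * y \in N.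

Fact coset_eq_refl : reflexive coset_eq.
Proof. by move=> x; rewrite /coset_eq mulVg gpred1. Qed.

Fact coset_eq_sym : symmetric coset_eq.
Proof. by move=> x y; rewrite /coset_eq -gpredV invgM invgK. Qed.

Fact coset_eq_trans : transitive coset_eq.
Proof.
move=> y x z xy yz; rewrite /coset_eq.
by rewrite -[z](mulVKg y) mulgA gpredM.
Qed.

Canonical coset_equiv :=
  EquivRel coset_eq coset_eq_refl coset_eq_sym coset_eq_trans.

Definition quotient_group := {eq_quot coset_equiv}.

HB.instance Definition _ := Choice.on quotient_group.

Definition quotient_pi (x : G) : quotient_group :=
  \pi_({eq_quot coset_equiv}) x.

Definition quotient_repr (a : quotient_group) : G :=
  repr (a : {eq_quot coset_equiv}).

Definition quotient_one : quotient_group := quotient_pi 1.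
Definition quotient_mul (a b : quotient_group) : quotient_group :=
  quotient_pi (quotient_repr a * quotient_repr b).
Definition quotient_inv (a : quotient_group) : quotient_group :=
  quotient_pi (quotient_repr a)^-1.

Lemma quotient_piP (x y : G) :
  quotient_pi x = quotient_pi y <-> x^-1 * y \in N.
Proof. by split=> [/eqP|?]; [|apply/eqP]; rewrite eqmodE. Qed.

Lemma quotient_reprK : cancel quotient_repr quotient_pi.
Proof. exact: reprK. Qed.

Lemma quotient_piM (x y : G) :
  quotient_pi (x * y) = quotient_mul (quotient_pi x) (quotient_pi y).
Proof.
rewrite /quotient_mul.
have /quotient_piP := quotient_reprK (quotient_pi x).
have /quotient_piP := quotient_reprK (quotient_pi y).
set x' := quotient_repr (quotient_pi x).
set y' := quotient_repr (quotient_pi y) => Ny Nx.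
apply/esym/quotient_piP.
have -> : (x' * y')^-1 * (x * y) = (x'^-1 * x) ^ y' * (y'^-1 * y).
  by rewrite /conjg invgM -!mulgA mulVKg.
by rewrite gpredM // gpredJ.
Qed.

Lemma quotient_piV (x : G) :
  quotient_pi x^-1 = quotient_inv (quotient_pi x).
Proof.
rewrite /quotient_inv.
have /quotient_piP := quotient_reprK (quotient_pi x).
set x' := quotient_repr (quotient_pi x) => Nx.
apply/quotient_piP; rewrite invgK.
have -> : x * x'^-1 = (x'^-1 * x) ^ x'^-1 by rewrite /conjg invgK !mulgA mulgV mul1g.
exact: gpredJ.
Qed.

Fact quotient_mulA : associative quotient_mul.
Proof.
move=> a b c.
rewrite -[a]quotient_reprK -[b]quotient_reprK -[c]quotient_reprK.
by rewrite -!quotient_piM mulgA.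
Qed.

Fact quotient_mul1g : left_id quotient_one quotient_mul.
Proof. by move=> a; rewrite -[a]quotient_reprK -quotient_piM mul1g. Qed.

Fact quotient_mulg1 : right_id quotient_one quotient_mul.
Proof. by move=> a; rewrite -[a]quotient_reprK -quotient_piM mulg1. Qed.

Fact quotient_mulVg : left_inverse quotient_one quotient_inv quotient_mul.
Proof.
by move=> a; rewrite -[a]quotient_reprK -quotient_piV -quotient_piM mulVg.
Qed.

Fact quotient_mulgV : right_inverse quotient_one quotient_inv quotient_mul.
Proof.
by move=> a; rewrite -[a]quotient_reprK -quotient_piV -quotient_piM mulgV.
Qed.

HB.instance Definition _ := isGroup.Build quotient_group
  quotient_mulA quotient_mul1g quotient_mulg1 quotient_mulVg quotient_mulgV.
End QuotientGroup.

Section Generation.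
Variable G : groupType.

Definition generated (X : set G) : {pred G} :=
  fun x => `[< forall S : groupClosed G, X `<=` [set` S] -> x \in S >].

Lemma generatedP (X : set G) (x : G) :
  reflect (forall S : groupClosed G, X `<=` [set` S] -> x \in S)
          (x \in generated X).
Proof. exact: asboolP. Qed.

Fact generated_mul (X : set G) : mulg_closed (generated X).
Proof.
move=> x y /generatedP Xx /generatedP Xy; apply/generatedP => S XS.
by rewrite gpredM ?Xx ?Xy.
Qed.

Fact generated_one (X : set G) : 1 \in generated X.
Proof. by apply/generatedP => S _; rewrite gpred1. Qed.

Fact generated_inv (X : set G) : invg_closed (generated X).
Proof.
by move=> x /generatedP Xx; apply/generatedP => S XS; rewrite gpredV Xx.
Qed.

HB.instance Definition _ (X : set G) :=
  isMulClosed.Build G (generated X) (@generated_mul X).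
HB.instance Definition _ (X : set G) :=
  isMul1Closed.Build G (generated X) (generated_one X).
HB.instance Definition _ (X : set G) :=
  isInvClosed.Build G (generated X) (@generated_inv X).

(* The elements are not required to be distinct. *)
Definition k_generated (k : nat) : Prop :=
  exists g : 'I_k -> G, forall x : G, x \in generated (range g).

Definition finitely_generated : Prop := exists k, k_generated k.

End Generation.

Section DerivedSeries.
Variable G : groupType.

Fixpoint derived (n : nat) : {pred G} :=
  if n is m.+1 then
    generated [set z | exists x y : G,
      [/\ x \in derived m, y \in derived m & z = [~ x, y]]]
  else predT.

Fact derived_mul n : mulg_closed (derived n).
Proof. by case: n => [|n] //=; exact: generated_mul. Qed.

Fact derived_one n : 1 \in derived n.
Proof. by case: n => [|n] //=; exact: generated_one. Qed.

Fact derived_inv n : invg_closed (derived n).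
Proof. by case: n => [|n] //=; exact: generated_inv. Qed.

HB.instance Definition _ n := isMulClosed.Build G (derived n) (@derived_mul n).
HB.instance Definition _ n := isMul1Closed.Build G (derived n) (derived_one n).
HB.instance Definition _ n := isInvClosed.Build G (derived n) (@derived_inv n).

Fact derived_conj n (x y : G) : x \in derived n -> x ^ y \in derived n.
Proof.
elim: n x => [|n IHn] x //= /generatedP Xx; apply/generatedP => S XS.
pose T : {pred G} := [pred z | z ^ y \in S].
have TM : mulg_closed T by move=> u v; rewrite !inE conjMg; exact: gpredM.
have T1 : 1 \in T by rewrite inE conj1g gpred1.
have TV : invg_closed T by move=> u; rewrite !inE conjVg gpredV.
pose C : groupClosed G := HB.pack T (isMulClosed.Build G T TM)
  (isMul1Closed.Build G T T1) (isInvClosed.Build G T TV).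
apply: (Xx C) => z [u [v [uD vD ->]]] /=.
rewrite inE /= conjRg; apply: XS.
by exists (u ^ y), (v ^ y); split=> //; exact: IHn.
Qed.

HB.instance Definition _ n := isConjClosed.Build G (derived n) (@derived_conj n).

Definition solvable_of_length (l : nat) : Prop :=
  (forall x : G, x \in derived l -> x = 1) /\
  (forall k, (k < l)%N -> exists2 x : G, x \in derived k & x <> 1).

Definition abelianization : groupType := quotient_group (derived 1).

End DerivedSeries.

Definition abelian_group (A : groupType) : Prop := forall x y : A, x * y = y * x.

Definition torsion_free (A : groupType) : Prop :=
  forall (x : A) (n : nat), (0 < n)%N -> x ^+ n = 1 -> x = 1.

Definition zexpg (A : groupType) (x : A) (z : int) : A :=
  match z with Posz n => x ^+ n | Negz n => x ^- n.+1 end.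

Definition abelian_basis (A : groupType) (B : set A) : Prop :=
  (forall x : A, x \in generated B) /\
  (forall (s : seq A) (e : A -> int), uniq s -> [set` s] `<=` B ->
     \prod_(b <- s) zexpg b (e b) = 1 -> forall b, b \in s -> e b = 0%R).

Definition free_abelian (A : groupType) : Prop :=
  abelian_group A /\ exists B : set A, abelian_basis B.

Definition embeds (G H : groupType) : Prop :=
  exists f : {multiplicative G -> H}, injective f.

Definition left_coset (G : groupType) (K : groupClosed G) (x : G) : set G :=
  [set x * k | k in [set` K]].

Definition finite_index (G : groupType) (K : groupClosed G) : Prop :=
  finite_set (range (left_coset K)).

(* A word in the variables x_0, x_1, ... is a list of letters; [(i, false)]
   stands for x_i and [(i, true)] for its inverse.                            *)
Definition word := seq (nat * bool).

Definition eval_word (G : groupType) (v : nat -> G) (w : word) : G :=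
  \prod_(p <- w) (if p.2 then (v p.1)^-1 else v p.1).

Definition group_class := groupType -> Prop.

Definition is_variety (M : group_class) : Prop :=
  exists L : set word, forall G : groupType,
    M G <-> (forall w, L w -> forall v : nat -> G, eval_word v w = 1).

Definition product_variety (M N : group_class) : group_class :=
  fun H => exists K : normalClosed H,
    M (subgroup_type K) /\ N (quotient_group K).

(* Main.v *)
From HB Require Import structures.
Require Import Defs.
From mathcomp Require Import all_boot.
From mathcomp Require Import ssralg ssrnum ssrint intdiv zify.
From mathcomp Require Import boolp classical_sets functions cardinality.

(** Let [G] be countable.  All three parts come from one 2-generated subgroup
    [H] of the unrestricted wreath product of [G] by the integers, whose
    elements are pairs of a function [int -> G] and a translation.  The
    generators are the translation by 1 and the function [spread] that takes
    the value [y] at the place [u y], for every [y] in [G], and is trivial at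
    all other places.  The places [u y] are distinct powers of 3, so a nonzero
    difference [u y - u x] determines [y] and [x].

    For each [x], the group [H] contains the translate [f_x] of [spread] whose
    value at 0 is [x]; its other nontrivial values are [y] at [u y - u x].  If
    [x <> y] then [f_x] and [f_y] are both nontrivial at most at 0, so that
    their commutator is [[x, y]] concentrated at 0.  Hence [H] contains a copy
    of [G'] concentrated at 0 ([delta_gen]).

    Now let [B] be an independent subset of [G/G'] and let [K] be the preimage
    of its span.  For [b] in [B], the coordinate along [b] is a homomorphism
    from [K] to the integers.  Send [g] in [K] to the function with value [g]
    at 0 and with value [y ^ c] at [u y - u x], where [c] is the [b]-coordinate
    of [g] if [x] is the chosen representative of some [b] in [B], and [c = 0]
    otherwise.  At every place this is a homomorphism on [K], and at 0 it is
    the inclusion, so it embeds [K] into the base group.  It sends the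
    representative [x] of [b] to [f_x], and it sends [z] in [G'] to [z]
    concentrated at 0.  As [K] is generated by the representatives and [G'],
    its image lies in [H] ([power_family_gen]).

    The elements of [H] without translation part form a normal subgroup with
    abelian quotient, and this subgroup satisfies the laws of [G] at each
    place.  For the derived length, [H'] consists of functions, which gives the
    upper bound; and the commutator of [f_x] with a translation takes the value
    [x^-1] at 0, because no difference [u y - u x] equals 1.  So evaluation at
    0 maps [H'] onto [G], which gives the lower bound.

    It remains to choose [B].  If [G/G'] is free abelian, [B] is a basis.  If
    it is finitely generated and torsion-free, a generating family of least
    size is a basis: a nontrivial relation can be shortened by the Euclidean
    algorithm until it kills one generator.  If it is only finitely generated,
    some independent [B] spans a subgroup of finite index
    ([finite_span_quasi_free]). *)

Set Implicit Arguments.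
Unset Strict Implicit.
Unset Printing Implicit Defensive.

Import GRing.Theory.
Local Open Scope classical_set_scope.

(** * Independence and coordinates in additive abelian groups *)

Section Combinations.
Local Open Scope ring_scope.
Variable V : zmodType.
Implicit Types (B : set V) (a : V) (e : V -> int).

(** The coefficient function is required to vanish off the list, so that it is
    determined by [a] when [B] is independent. *)
Definition combination B a e := exists s : seq V,
  [/\ uniq s, [set` s] `<=` B, forall b, b \notin s -> e b = 0
    & a = \sum_(b <- s) b *~ e b].

Definition span B : set V := [set a | exists e, combination B a e].

Definition independent B := forall (s : seq V) (e : V -> int),
  uniq s -> [set` s] `<=` B -> \sum_(b <- s) b *~ e b = 0 ->
  forall b, b \in s -> e b = 0.

Lemma sum_widen (s t : seq V) e : uniq s -> uniq t -> {subset s <= t} ->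
  (forall b, b \notin s -> e b = 0) ->
  \sum_(b <- t) b *~ e b = \sum_(b <- s) b *~ e b.
Proof.
move=> us ut st e0; rewrite (bigID (mem s)) /= [X in _ + X]big1 ?addr0; last first.
  by move=> b /e0 ->; rewrite mulr0z.
rewrite -big_filter; apply: perm_big; apply: uniq_perm; rewrite ?filter_uniq //.
by move=> b; rewrite mem_filter; case: (boolP (b \in s)) => // /st ->.
Qed.

Lemma combinationB B a a' e e' : combination B a e -> combination B a' e' ->
  combination B (a - a') (fun b => e b - e' b).
Proof.
move=> [s [us sB s0 ->]] [s' [us' sB' s0' ->]].
exists (undup (s ++ s')); split; first exact: undup_uniq.
- by move=> b /=; rewrite mem_undup mem_cat => /orP[/sB|/sB'].
- by move=> b; rewrite mem_undup mem_cat negb_or => /andP[/s0 -> /s0' ->].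
under [RHS]eq_bigr do rewrite mulrzBr; rewrite big_split /= sumrN; congr (_ - _);
by apply/esym/sum_widen => //; rewrite ?undup_uniq // => b bs;
  rewrite mem_undup mem_cat bs ?orbT.
Qed.

Lemma combination0 B : combination B 0 (fun=> 0).
Proof. by exists [::]; rewrite big_nil; split=> // b. Qed.

Lemma combination_mem B b : B b -> combination B b (fun c => (c == b)%:R).
Proof.
move=> Bb; exists [:: b]; split=> //.
- by move=> c /=; rewrite inE => /eqP->.
- by move=> c; rewrite inE => /negPf ->.
by rewrite big_seq1 eqxx.
Qed.

Lemma combination_unique B a e e' : independent B ->
  combination B a e -> combination B a e' -> e =1 e'.
Proof.
move=> indB ae ae' b; have [s [us sB s0]] := combinationB ae ae'.
rewrite subrr => /esym /(indB _ _ us sB) ee'; apply/eqP; rewrite -subr_eq0.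
by apply/eqP; case: (boolP (b \in s)) => [/ee'|/s0].
Qed.

Lemma span0 B : span B 0.
Proof. by exists (fun=> 0); exact: combination0. Qed.

Lemma spanB B a a' : span B a -> span B a' -> span B (a - a').
Proof. by move=> [e ae] [e' ae']; eexists; exact: combinationB ae ae'. Qed.

Lemma mem_span B b : B b -> span B b.
Proof. by move/combination_mem; exists (fun c => (c == b)%:R). Qed.

Lemma spanN B a : span B a -> span B (- a).
Proof. by move=> Ba; rewrite -[- a]add0r; apply: spanB => //; exact: span0. Qed.

Lemma spanD B a a' : span B a -> span B a' -> span B (a + a').
Proof. by move=> Ba Ba'; rewrite -[a']opprK; apply/spanB/spanN. Qed.

Lemma span_mulrz B a m : span B a -> span B (a *~ m).
Proof.
have spanMn n : span B a -> span B (a *+ n).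
  by move=> Ba; elim: n => [|n IHn]; rewrite ?mulrS; [exact: span0|exact: spanD].
by case: m => n Ba; [exact: spanMn|apply/spanN/spanMn].
Qed.

Lemma span_ind B (P : set V) : P 0 -> (forall x y, P x -> P y -> P (x - y)) ->
  B `<=` P -> span B `<=` P.
Proof.
move=> P0 PB BP a [e [s [_ sB _ ->]]].
have PN x : P x -> P (- x) by move=> Px; rewrite -[- x]add0r; exact: PB.
have PD x y : P x -> P y -> P (x + y).
  by move=> Px Py; rewrite -[y]opprK; apply/PB/PN.
have PM x n : P x -> P (x *+ n).
  by move=> Px; elim: n => [|n IHn]; rewrite ?mulr0n // mulrS; exact: PD.
rewrite big_seq; apply: (big_ind P) => // b /sB/BP Pb.
by case: (e b) => n; [exact: PM|exact/PN/PM].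
Qed.

Lemma span_sub B C : B `<=` span C -> span B `<=` span C.
Proof. by apply: span_ind; [exact: span0|exact: spanB]. Qed.

Lemma span_cons y (ys : seq V) a : span [set` y :: ys] a ->
  exists m a', span [set` ys] a' /\ a = y *~ m + a'.
Proof.
move: a; apply: span_ind => [|a b [m [a' [sa ->]]] [n [b' [sb ->]]]|b].
- by exists 0, 0; split; [exact: span0|rewrite mulr0z addr0].
- exists (m - n), (a' - b'); split; first exact: spanB.
  by rewrite mulrzBr opprD addrACA.
rewrite /= inE => /orP[/eqP->|bys].
  by exists 1, 0; split; [exact: span0|rewrite mulr1z addr0].
by exists 0, b; split; [exact: mem_span|rewrite mulr0z add0r].
Qed.

Lemma independentU1 B y : independent B ->
  (forall m : int, span B (y *~ m) -> m = 0) -> independent (y |` B).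
Proof.
move=> indB yB s e us sB; case: (boolP (y \in s)) => [ys|yNs]; last first.
  apply: indB => // b bs; case: (sB _ bs) => // by_.
  by move: yNs; rewrite -by_ bs.
have remB : [set` rem y s] `<=` B.
  move=> b /=; rewrite mem_rem_uniq // !inE => /andP[byN bs].
  by case: (sB _ bs) => // by_; rewrite by_ eqxx in byN.
rewrite (big_rem y) //= => s0.
have ey : e y = 0.
  apply: yB; rewrite -[_ *~ _]opprK (addr0_eq s0) big_seq; apply: spanN.
  apply: (big_ind (span B)) => [||b /remB Bb]; first exact: span0.
    exact: spanD.
  exact/span_mulrz/mem_span.
move: s0; rewrite ey mulr0z add0r => /(indB _ _ (rem_uniq y us) remB) e0 b bs.
by have [->//|by_] := eqVneq b y; apply: e0; rewrite mem_rem_uniq // !inE by_.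
Qed.

(** A finitely generated abelian group is a finite union of cosets of a free
    one.  Going through the generators, either no positive multiple of [y] lies
    in the span of [B], and then [y] can be added to [B]; or [y *+ n] lies there
    for some [n > 0], and then the multiples [y *+ c] with [c < n] represent all
    new cosets. *)
Lemma finite_span_quasi_free (ys : seq V) : exists (B : set V) (F : seq V),
  independent B /\ forall a, span [set` ys] a -> exists2 f, f \in F & span B (a - f).
Proof.
elim: ys => [|y ys [B [F [indB FB]]]].
  exists set0, [:: 0]; split=> [s e _ s0 _ b /s0 //|a a0].
  exists 0; rewrite ?inE // subr0; apply: span_sub a0 => b //.
have [[n n0 yn]|yB] := pselect (exists2 n, (0 < n)%N & span B (y *+ n)).
  exists B, [seq f + y *+ c | f <- F, c <- iota 0 n]; split=> // a.
  move=> /span_cons[m [a' [/FB[f fF aB] ->]]].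
  have [c cn mc] : exists2 c, (c < n)%N & m = (m %/ n)%Z * n%:Z + c%:Z.
    exists `|(m %% n)%Z|%N; first lia.
    by rewrite [LHS](divz_eq m n); congr (_ + _); lia.
  exists (f + y *+ c).
    by apply/allpairsP; exists (f, c); split; rewrite ?mem_iota.
  have -> : y *~ m + a' - (f + y *+ c) = (a' - f) + (y *+ n) *~ (m %/ n)%Z.
    rewrite [in LHS]mc mulrzDr [(_ %/ _)%Z * _]mulrC mulrzA opprD -!pmulrn.
    by rewrite [_ + a']addrC addrACA addrK.
  exact/spanD/span_mulrz.
exists (y |` B), F; split.
  apply: independentU1 => // m ym; apply: contrapT => m0; apply: yB.
  exists `|m|%N; first by rewrite absz_gt0; apply/eqP.
  rewrite pmulrn; case: (m) ym => k; first by [].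
  by move=> /spanN; rewrite opprK.
move=> a /span_cons[m [a' [/FB[f fF aB] ->]]]; exists f => //.
rewrite -addrA; apply: spanD; first by apply/span_mulrz/mem_span; left.
by apply: span_sub aB => b Bb; apply: mem_span; right.
Qed.

Definition torsion_free_zmod := forall (a : V) n, (0 < n)%N -> a *+ n = 0 -> a = 0.

(** Induction on the sum of the absolute values of the coefficients.  If [x]
    and [y] have nonzero coefficients [k] and [m] with [|m| <= |k|], then
    [x *~ k + y *~ m = x *~ (k - sg * m) + (y + x *~ sg) *~ m] for [sg = 1] or
    [sg = -1], and [x], [y + x *~ sg] generate the same subgroup as [x], [y];
    the sign is chosen to make [|k - sg * m|] smaller than [|k|].  When only one
    nonzero coefficient is left, its generator has finite order, hence is 0. *)
Lemma shorten_relation (r : seq (V * int)) : torsion_free_zmod ->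
  \sum_(p <- r) p.1 *~ p.2 = 0 -> (exists2 p, p \in r & p.2 != 0) ->
  exists2 zs : seq V, (size zs < size r)%N &
    forall p, p \in r -> span [set` zs] p.1.
Proof.
move=> tfV; have [n] := ubnP (\sum_(p <- r) `|p.2|)%N.
elim: n r => // n IHn r le_rn r0 [[x k] xr /= k0].
have step x1 k1 y m r2 : perm_eq r [:: (x1, k1), (y, m) & r2] -> m != 0 ->
    (`|m| <= `|k1|)%N -> exists2 zs : seq V, (size zs < size r)%N &
    forall p, p \in r -> span [set` zs] p.1.
  move=> rE m0 mk; pose sg : int := if (0 <= k1) == (0 <= m) then 1 else -1.
  have [||| zs zsr spanzs] := IHn [:: (x1, k1 - sg * m), (y + x1 *~ sg, m) & r2].
  - have k1_lt : (`|(k1 - sg * m)%R| < `|k1|)%N.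
      by rewrite /sg; case: ifP => /eqP; lia.
    by move: le_rn k1_lt; rewrite (perm_big _ rE) /= !big_cons /=; lia.
  - rewrite -[RHS]r0 (perm_big _ rE) /= !big_cons /= mulrzBr mulrzDl -mulrzA.
    by rewrite [y *~ m + _]addrC !addrA subrK.
  - by exists (y + x1 *~ sg, m) => //; rewrite !inE eqxx orbT.
  exists zs; first by rewrite (perm_size rE).
  have zsx : span [set` zs] x1 by apply: (spanzs (_, _)); exact: mem_head.
  move=> p; rewrite (perm_mem rE) !inE => /or3P[/eqP->//|/eqP->/=|pr2].
    rewrite -(addrK (x1 *~ sg) y); apply: spanB; last exact: span_mulrz.
    by apply: (spanzs (_, m)); rewrite !inE eqxx orbT.
  by apply: spanzs; rewrite !inE pr2 !orbT.
have rE := perm_to_rem xr; set r1 := rem _ _ in rE.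
have [[[y m] yr1 /= m0]|r1_0] := pselect (exists2 q, q \in r1 & q.2 != 0).
  have {rE}rE : perm_eq r [:: (x, k), (y, m) & rem (y, m) r1].
    by apply: perm_trans rE _; rewrite perm_cons perm_to_rem.
  have [mk|km] := leqP `|m| `|k|; first exact: step rE m0 mk.
  apply: (step y m x k) (ltnW km) => //; apply: perm_trans rE _.
  by apply/permP => P /=; rewrite addnCA.
have x0 : x = 0.
  have xk : x *~ k = 0.
    rewrite -[RHS]r0 (perm_big _ rE) /= big_cons big_seq big1 ?addr0 // => q qr1.
    have [->|q0] := eqVneq q.2 0; first by rewrite mulr0z.
    by case: r1_0; exists q.
  apply: (tfV _ `|k|%N); first lia.
  by case: (k) xk => // j /eqP; rewrite oppr_eq0 => /eqP.
exists (unzip1 r1); first by rewrite (perm_size rE) size_map.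
move=> p; rewrite (perm_mem rE) inE => /orP[/eqP->|pr1].
  by rewrite x0; exact: span0.
by apply: mem_span; exact: map_f.
Qed.

(** A nontrivial relation among the generators can be traded for a shorter
    generating list by [shorten_relation], so the process stops at a basis. *)
Lemma torsion_free_span_basis (ys : seq V) : torsion_free_zmod ->
  exists2 B : set V, independent B & span [set` ys] `<=` span B.
Proof.
move=> tfV; have [n] := ubnP (size ys); elim: n ys => // n IHn ys le_ysn.
have [indys|] := pselect (independent [set` ys]); first by exists [set` ys].
move=> /existsNP[s /existsNP[e /not_implyP[us /not_implyP[sys /not_implyP[s0]]]]].
move=> /existsNP[b /not_implyP[bs /eqP eb0]].
pose e' b := if b \in s then e b else 0.
have [|| zs zsys spanzs] := @shorten_relation [seq (y, e' y) | y <- undup ys] tfV.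
- rewrite big_map /= -[RHS]s0 (@sum_widen s) ?undup_uniq //.
  + by rewrite !big_seq; apply: eq_bigr => c cs; rewrite /e' cs.
  + by move=> c /sys /=; rewrite mem_undup.
  + by move=> c /negPf; rewrite /e' => ->.
- by exists (b, e' b); [apply: map_f; rewrite mem_undup; exact: sys|rewrite /e' bs].
have [|B indB spanB] := IHn zs.
  rewrite size_map in zsys.
  exact: leq_trans zsys (leq_trans (size_undup ys) le_ysn).
exists B => //; apply: subset_trans spanB; apply: span_sub => y yys.
by apply: (spanzs (y, e' y)); apply: map_f; rewrite mem_undup.
Qed.

(** The value outside the span of [B] is arbitrary. *)
Definition coord (B : set V) (a : V) : V -> int :=
  if pselect (span B a) is left h then projT1 (cid h) else fun=> 0.

Lemma coord_unique B a e : independent B -> combination B a e ->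
  coord B a =1 e.
Proof.
move=> indB ae; rewrite /coord; case: pselect => [h|[]]; last by exists e.
by case: cid => e' /= ae'; exact: combination_unique ae.
Qed.

Lemma coordB B a a' : independent B -> span B a -> span B a' ->
  coord B (a - a') =1 (fun b => coord B a b - coord B a' b).
Proof.
move=> indB [e ae] [e' ae'] b.
rewrite (coord_unique indB (combinationB ae ae')).
by rewrite (coord_unique indB ae) (coord_unique indB ae').
Qed.

Lemma coord0 B : independent B -> coord B 0 =1 fun=> 0.
Proof. by move=> indB; exact/coord_unique/combination0. Qed.

Lemma coordD B a a' : independent B -> span B a -> span B a' ->
  coord B (a + a') =1 (fun b => coord B a b + coord B a' b).
Proof.
move=> indB Ba Ba' b; rewrite -[a']opprK (coordB indB Ba (spanN Ba')).
have := coordB indB (span0 B) Ba' b; rewrite sub0r => ->.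
by rewrite (coord0 indB) !opprK sub0r opprK.
Qed.

Lemma coord_mem B b : independent B -> B b -> coord B b =1 fun c => (c == b)%:R.
Proof. by move=> indB Bb; exact/coord_unique/combination_mem. Qed.

End Combinations.

(** * Generated subgroups *)

Local Open Scope group_scope.

(** Lets a closure property of [generated X] be proved for an arbitrary set [P],
    without building a [groupClosed] predicate each time. *)
Lemma generated_min (G : groupType) (X P : set G) : P 1 ->
  (forall x y, P x -> P y -> P (x * y)) -> (forall x, P x -> P x^-1) ->
  X `<=` P -> forall x, x \in generated X -> P x.
Proof.
move=> P1 PM PV XP x /generatedP Xx; pose S : {pred G} := fun z => `[<P z>].
have SM : mulg_closed S by move=> y z /asboolP Py /asboolP Pz; apply/asboolP/PM.
have S1 : 1 \in S by apply/asboolP.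
have SV : invg_closed S by move=> y /asboolP Py; apply/asboolP/PV.
pose C : groupClosed G := HB.pack S (isMulClosed.Build G S SM)
  (isMul1Closed.Build G S S1) (isInvClosed.Build G S SV).
by apply/asboolP; apply: (Xx C) => y /XP Py; apply/asboolP.
Qed.

Lemma mem_generated (G : groupType) (X : set G) x : X x -> x \in generated X.
Proof. by move=> Xx; apply/generatedP => S; exact. Qed.

Definition in_subgroup (G : groupType) (S : groupClosed G) (x : G)
  (xS : x \in S) : subgroup_type S := exist _ x xS.

Lemma val_in_subgroup (G : groupType) (S : groupClosed G) (x : G)
  (xS : x \in S) : val (in_subgroup xS) = x.
Proof. by []. Qed.

Lemma generated_subgroup_type (G : groupType) (X : set G)
    (x : subgroup_type (generated X)) : x \in generated (val @^-1` X).
Proof.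
suff [y] : exists2 y : subgroup_type (generated X),
    y \in generated (val @^-1` X) & val y = val x.
  by move=> yX /val_inj <-.
move: (valP x); move: (val x); apply: generated_min.
- by exists 1; [exact: gpred1|].
- by move=> _ _ [y Xy <-] [z Xz <-]; exists (y * z); [exact: gpredM|].
- by move=> _ [y Xy <-]; exists y^-1; [rewrite gpredV|].
move=> y Xy; by exists (in_subgroup (mem_generated Xy)); [apply: mem_generated|].
Qed.

(** Every element is the value of a word in the generators, and there are
    countably many words. *)
Lemma fg_countable (G : groupType) : finitely_generated G -> countable [set: G].
Proof.
move=> [k [g gG]].
pose ev (w : seq ('I_k * bool)) := \prod_(p <- w) (if p.2 then (g p.1)^-1 else g p.1).
have evP x : exists w, ev w = x.
  move: x (gG x); apply: generated_min.
  - by exists [::]; rewrite /ev big_nil.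
  - by move=> _ _ [v <-] [w <-]; exists (v ++ w); rewrite /ev big_cat.
  - move=> _ [w <-]; exists (rev [seq (p.1, ~~ p.2) | p <- w]).
    rewrite /ev; elim: w => [|[i b] w IHw]; first by rewrite !big_nil invg1.
    rewrite /= rev_cons -cats1 big_cat /= IHw big_seq1 big_cons invgM.
    by congr (_ * _); case: b; rewrite //= invgK.
  - by move=> _ [i _ <-]; exists [:: (i, false)]; rewrite /ev big_seq1.
have {evP} /choice[c cK] := evP.
apply/countable_injP; exists (fun x => pickle (c x)) => x y _ _ /(pcan_inj pickleK).
by move=> cxy; rewrite -(cK x) cxy.
Qed.

(** * The abelianization as an additive group *)

(** An alias of [A] that carries the additive structure, where sums and integer
    multiples can be used. *)
Definition additive_of (A : groupType) (abA : abelian_group A) : Type := A.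

Section Additive.
Variables (A : groupType) (abA : abelian_group A).
HB.instance Definition _ := Choice.on (additive_of abA).
HB.instance Definition _ := GRing.isZmodule.Build (additive_of abA)
  (@mulgA A) abA (@mul1g A) (@mulVg A).

Lemma expg_additive (x : additive_of abA) n : (x : A) ^+ n = (x *+ n)%R.
Proof. by elim: n => // n IHn; rewrite expgS IHn mulrS. Qed.

Lemma zexpg_additive (x : additive_of abA) z : zexpg (x : A) z = (x *~ z)%R.
Proof. by case: z => n /=; rewrite expg_additive. Qed.

Lemma prod_additive (I : Type) (s : seq I) (F : I -> additive_of abA) :
  \prod_(i <- s) (F i : A) = (\sum_(i <- s) F i)%R.
Proof. by elim: s => [|i s IHs]; rewrite ?big_nil // !big_cons IHs. Qed.

Lemma abelian_basis_additive (B : set A) : abelian_basis B ->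
  independent (B : set (additive_of abA)) /\
  forall x, span (B : set (additive_of abA)) x.
Proof.
move=> [genB indB]; split=> [s e us sB s0|x]; last first.
  move: x (genB x); apply: generated_min => [|y z|y|y] //.
  - exact: span0.
  - exact: spanD.
  - exact: spanN.
  - exact: mem_span.
apply: (indB s e us sB); rewrite -[RHS]s0 -prod_additive.
by apply: eq_bigr => b _; exact: zexpg_additive.
Qed.
End Additive.

Lemma abelianization_abelian (G : groupType) : abelian_group (abelianization G).
Proof.
move=> x y; rewrite -[x]quotient_reprK -[y]quotient_reprK.
rewrite -[LHS]quotient_piM -[RHS]quotient_piM.
apply/quotient_piP; set a := quotient_repr x; set b := quotient_repr y.
apply: mem_generated; exists b, a; split=> //.
by rewrite /commg /conjg invgM !mulgA.
Qed.

Section Abelianization.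
Variable G : groupType.

Definition additive_abelianization := additive_of (@abelianization_abelian G).
HB.instance Definition _ := GRing.Zmodule.on additive_abelianization.

Definition ab (x : G) : additive_abelianization := quotient_pi (@derived G 1) x.
Definition ab_repr (a : additive_abelianization) : G := quotient_repr a.

Lemma ab_reprK : cancel ab_repr ab. Proof. exact: quotient_reprK. Qed.
Lemma abM x y : ab (x * y) = (ab x + ab y)%R. Proof. exact: quotient_piM. Qed.
Lemma ab1 : ab 1 = 0%R. Proof. by []. Qed.
Lemma abV x : ab x^-1 = (- ab x)%R. Proof. exact: quotient_piV. Qed.
Lemma abF x y : ab (x / y) = (ab x - ab y)%R. Proof. by rewrite abM abV. Qed.
Lemma ab_eq0 x : ab x = 0%R <-> x \in derived 1.
Proof.
have -> : x \in derived 1 = (x^-1 * 1 \in derived 1) by rewrite mulg1 gpredV.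
exact: quotient_piP.
Qed.

Lemma span_ab_generators k (g : 'I_k -> G) :
  (forall x, x \in generated (range g)) ->
  forall a, span [set` [seq ab (g i) | i <- enum 'I_k]] a.
Proof.
move=> gG a; rewrite -[a]ab_reprK; move: (ab_repr a) (gG (ab_repr a)).
apply: generated_min => [|x y|x|_ [i _ <-]].
- exact: span0.
- by rewrite abM; exact: spanD.
- by rewrite abV; exact: spanN.
by apply/mem_span/map_f; rewrite mem_enum.
Qed.
End Abelianization.

Lemma zexpgD (G : groupType) (x : G) (m n : int) :
  zexpg x (m + n)%R = zexpg x m * zexpg x n.
Proof.
have zexpgS k : zexpg x (1 + k)%R = x * zexpg x k.
  case: k => [n0|[|n0]]; [exact: expgS|by rewrite /= expg1 mulgV|].
  rewrite (_ : (1 + _)%R = Negz n0); last lia.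
  by rewrite [in RHS]/= [in RHS]expgSr invgM mulVKg.
have zexpgP k : zexpg x (-1 + k)%R = x^-1 * zexpg x k.
  by rewrite -[in RHS](_ : 1 + (-1 + k) = k)%R; [rewrite zexpgS mulKg|lia].
elim/int_ind: m => [|k IHk|k IHk]; first by rewrite add0r mul1g.
  by rewrite intS -addrA !zexpgS IHk mulgA.
rewrite intS opprD -addrA.
by rewrite !zexpgP IHk mulgA.
Qed.

(** * The unrestricted wreath product with the integers *)

(** A pair [(f, m)] stands for the function [f] followed by the translation by
    [m]: conjugation by translations shifts the argument of [f]. *)
Definition wreath (G : groupType) : Type := ((int -> G) * int)%type.

Section Wreath.
Variable G : groupType.

HB.instance Definition _ := Choice.on (wreath G).

Definition wreath_one : wreath G := (fun=> 1, 0%R).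
Definition wreath_mul (v w : wreath G) : wreath G :=
  (fun k => v.1 k * w.1 (k + v.2)%R, (v.2 + w.2)%R).
Definition wreath_inv (v : wreath G) : wreath G :=
  (fun k => (v.1 (k - v.2)%R)^-1, (- v.2)%R).

Lemma wreath_eq (v w : wreath G) : v.1 =1 w.1 -> v.2 = w.2 -> v = w.
Proof. by case: v w => [f m] [g n] /= /funext -> ->. Qed.

Fact wreath_mulA : associative wreath_mul.
Proof.
by move=> v w x; apply: wreath_eq => [k|] /=; rewrite ?mulgA -?addrA.
Qed.
Fact wreath_mul1g : left_id wreath_one wreath_mul.
Proof. by move=> v; apply: wreath_eq => [k|] /=; rewrite ?mul1g ?addr0 ?add0r. Qed.
Fact wreath_mulg1 : right_id wreath_one wreath_mul.
Proof. by move=> v; apply: wreath_eq => [k|] /=; rewrite ?mulg1 ?addr0. Qed.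
Fact wreath_mulVg : left_inverse wreath_one wreath_inv wreath_mul.
Proof. by move=> v; apply: wreath_eq => [k|] /=; rewrite ?mulVg ?addNr. Qed.
Fact wreath_mulgV : right_inverse wreath_one wreath_inv wreath_mul.
Proof. by move=> v; apply: wreath_eq => [k|] /=; rewrite ?addrK ?mulgV ?subrr. Qed.

HB.instance Definition _ := isGroup.Build (wreath G)
  wreath_mulA wreath_mul1g wreath_mulg1 wreath_mulVg wreath_mulgV.

Definition translation (m : int) : wreath G := (fun=> 1, m).
Definition base (f : int -> G) : wreath G := (f, 0%R).

Lemma wreathM1 (v w : wreath G) k : (v * w).1 k = v.1 k * w.1 (k + v.2)%R.
Proof. by []. Qed.
Lemma wreathM2 (v w : wreath G) : (v * w).2 = (v.2 + w.2)%R. Proof. by []. Qed.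
Lemma wreathV1 (v : wreath G) k : v^-1.1 k = (v.1 (k - v.2)%R)^-1.
Proof. by []. Qed.
Lemma wreathV2 (v : wreath G) : v^-1.2 = (- v.2)%R. Proof. by []. Qed.

Lemma wreathR2 (v w : wreath G) : [~ v, w].2 = 0%R.
Proof. rewrite /commg /conjg !(wreathM2, wreathV2); lia. Qed.

Lemma wreathR1 (v w : wreath G) k : v.2 = 0%R -> w.2 = 0%R ->
  [~ v, w].1 k = [~ v.1 k, w.1 k].
Proof.
move=> v0 w0; rewrite /commg /conjg !(wreathM1, wreathV1, wreathV2) v0 w0.
by rewrite !oppr0 !addr0.
Qed.

Lemma translationD m n : translation (m + n)%R = translation m * translation n.
Proof. by apply: wreath_eq => [k|] //; rewrite wreathM1 mulg1. Qed.

Lemma translationV m : translation (- m)%R = (translation m)^-1.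
Proof. by apply: wreath_eq => [k|] //; rewrite wreathV1 invg1. Qed.

Lemma baseM (f g : int -> G) : base (fun k => f k * g k) = base f * base g.
Proof. by apply: wreath_eq => [k|] //; rewrite wreathM1 addr0. Qed.

Lemma base_shift (f : int -> G) m :
  base (fun k => f (k + m)%R) = translation m * base f * translation (- m)%R.
Proof.
apply: wreath_eq => [k|]; last by rewrite !wreathM2 addr0 subrr.
by rewrite !wreathM1 mul1g mulg1.
Qed.

Section Subgroup.
Variable S : groupClosed (wreath G).
Local Notation H := (subgroup_type S).

(** Commutators have no translation part, so from the first derived subgroup on
    the group operations are pointwise. *)
Lemma derived_wreath n (h : H) : h \in derived n.+1 ->
  (val h).2 = 0%R /\ forall k, (val h).1 k \in derived n.
Proof.
elim: n h => [|n IHn]; apply: generated_min.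
- by split=> // k; exact: gpred1.
- move=> x y [x0 _] [y0 _]; split=> // .
  by rewrite gmulfM wreathM2 x0 y0.
- by move=> x [x0 _]; split=> //; rewrite gmulfV wreathV2 x0 oppr0.
- move=> _ [x [y [_ _ ->]]]; split=> //.
  by rewrite gmulfR wreathR2.
- by split=> // k; rewrite gmulf1 gpred1.
- move=> x y [x0 xD] [y0 yD]; rewrite gmulfM wreathM2 x0 y0; split=> // k.
  by rewrite wreathM1 gpredM.
- move=> x [x0 xD]; rewrite gmulfV wreathV2 x0 oppr0; split=> // k.
  by rewrite wreathV1 gpredV.
move=> _ [x [y [xD yD ->]]]; rewrite gmulfR wreathR2; split=> // k.
have [[x0 xk] [y0 yk]] := (IHn _ xD, IHn _ yD).
by rewrite wreathR1 //; apply: mem_generated; exists ((val x).1 k), ((val y).1 k).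
Qed.

(** On elements without translation part, evaluation at [k] is a homomorphism,
    so if it maps [H'] onto [G] then it maps each derived subgroup of [H'] onto
    the corresponding one of [G]. *)
Lemma derived_wreath_onto n (k : int) :
  (forall x : G, exists2 h : H, h \in derived 1 & (val h).1 k = x) ->
  forall x : G, x \in derived n -> exists2 h : H, h \in derived n.+1 & (val h).1 k = x.
Proof.
move=> onto; elim: n => [|n IHn] x; first by move=> _; exact: onto.
move: x; apply: generated_min.
- by exists 1; [exact: gpred1|rewrite gmulf1].
- move=> _ _ [g gD <-] [h hD <-]; exists (g * h); first exact: gpredM.
  have [g0 _] := derived_wreath gD.
  by rewrite gmulfM wreathM1 g0 addr0.
- move=> _ [g gD <-]; exists g^-1; first by rewrite gpredV.
  have [g0 _] := derived_wreath gD.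
  by rewrite gmulfV wreathV1 g0 subr0.
move=> _ [x [y [/IHn[g gD <-] /IHn[h hD <-] ->]]]; exists [~ g, h].
  by apply: mem_generated; exists g, h.
have [[g0 _] [h0 _]] := (derived_wreath gD, derived_wreath hD).
by rewrite gmulfR wreathR1.
Qed.

(** For [l = 0] the group [G] is trivial and the evaluation says nothing, whence
    the separate condition that the subgroup is nontrivial. *)
Lemma solvable_wreath l (k : int) : solvable_of_length G l ->
  (forall x : G, exists2 h : H, h \in derived 1 & (val h).1 k = x) ->
  (exists h : H, h <> 1) -> solvable_of_length H l.+1.
Proof.
move=> [Gl Gk] onto [h h1]; split=> [x /derived_wreath[x0 xl]|[_|n nl]].
- apply: val_inj; apply: wreath_eq => [i|]; last by rewrite x0 gmulf1.
  by rewrite (Gl _ (xl i)) gmulf1.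
- by exists h.
have [x xn x1] := Gk n nl; have [g gn gx] := derived_wreath_onto onto xn.
by exists g => // g1; apply: x1; rewrite -gx g1 gmulf1.
Qed.

Definition base_part : {pred H} := fun h => (val h).2 == 0%R.

Fact base_partM : mulg_closed base_part.
Proof. by move=> g h /eqP g0 /eqP h0; apply/eqP; rewrite gmulfM wreathM2 g0 h0. Qed.
Fact base_part1 : 1 \in base_part.
Proof. by apply/eqP; rewrite gmulf1. Qed.
Fact base_partV : invg_closed base_part.
Proof. by move=> g /eqP g0; apply/eqP; rewrite gmulfV wreathV2 g0 oppr0. Qed.
Fact base_partJ (g h : H) : g \in base_part -> g ^ h \in base_part.
Proof.
move=> /eqP g0; apply/eqP.
by rewrite gmulfJ /conjg !wreathM2 g0 wreathV2 add0r addNr.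
Qed.

HB.instance Definition _ := isMulClosed.Build H base_part base_partM.
HB.instance Definition _ := isMul1Closed.Build H base_part base_part1.
HB.instance Definition _ := isInvClosed.Build H base_part base_partV.
HB.instance Definition _ := isConjClosed.Build H base_part base_partJ.

(** The evaluations at integers are homomorphisms on [base_part S] which
    together separate its elements, so [base_part S] satisfies every law of [G];
    the quotient by it embeds in the integers. *)
Lemma wreath_product_variety (M : group_class) : is_variety M -> M G ->
  product_variety M abelian_group H.
Proof.
move=> [L ML] MG; exists (base_part : normalClosed H); split.
  apply/ML => w Lw v; apply/val_inj/val_inj; rewrite [RHS]gmulf1.
  pose coordinate k (h : subgroup_type base_part) := (val (val h)).1 k.
  have base0 (h : subgroup_type base_part) : (val (val h)).2 = 0%R.
    exact/eqP/(valP h).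
  have coordinateM k : {morph coordinate k : g h / g * h}.
    by move=> g h; rewrite /coordinate !gmulfM wreathM1 base0 addr0.
  have coordinateV k : {morph coordinate k : g / g^-1}.
    by move=> g; rewrite /coordinate !gmulfV wreathV1 base0 subr0.
  have evE k : coordinate k (eval_word v w) = eval_word (coordinate k \o v) w.
    rewrite /eval_word; elim: w {Lw} => [|[i b] w IHw].
      by rewrite !big_nil /coordinate !gmulf1.
    by rewrite !big_cons coordinateM IHw; case: b; rewrite /= ?coordinateV.
  apply: wreath_eq => [k|]; last exact: base0.
  by rewrite [LHS]evE; apply: (ML G).1.
move=> a b; rewrite -[a]quotient_reprK -[b]quotient_reprK.
set x := quotient_repr a; set y := quotient_repr b.
rewrite -[LHS]quotient_piM -[RHS]quotient_piM; apply/quotient_piP/eqP.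
rewrite gmulfM gmulfV !gmulfM wreathM2 wreathV2 !wreathM2.
by rewrite [(_ + (val x).2)%R]addrC; exact: addNr.
Qed.

End Subgroup.
End Wreath.

(** * Sidon sequences *)

(** The values of [u] form a Sidon set: a nonzero difference of two values
    determines both of them. *)
Definition sidon (T : Type) (u : T -> int) :=
  forall x y x' y', x <> y -> (u x - u y = u x' - u y')%R -> x = x' /\ y = y'.

(** If [d < b], then [3 ^ b] already exceeds [3 ^ c + 3 ^ d <= 2 * 3 ^ d]. *)
Lemma pow3_sum_le (a b c d : nat) : (a <= b)%N -> (c <= d)%N ->
  (3 ^ a + 3 ^ b = 3 ^ c + 3 ^ d)%N -> (b <= d)%N.
Proof.
move=> ab cd e; rewrite leqNgt; apply/negP => db.
have := leq_pexp2l (isT : 0 < 3)%N db; rewrite expnS.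
have := leq_pexp2l (isT : 0 < 3)%N cd; have := expn_gt0 3 a; lia.
Qed.

Lemma pow3_sum_inj_sorted (a b c d : nat) : (a <= b)%N -> (c <= d)%N ->
  (3 ^ a + 3 ^ b = 3 ^ c + 3 ^ d)%N -> a = c /\ b = d.
Proof.
move=> ab cd e; have bd : b = d.
  by apply/eqP; rewrite eqn_leq (pow3_sum_le ab cd e) (pow3_sum_le cd ab (esym e)).
by split=> //; move: e; rewrite bd => /addIn /eqP; rewrite eqn_exp2l // => /eqP.
Qed.

Lemma sidon_pow3 (T : Type) (c : T -> nat) : injective c ->
  sidon (fun x => (3 ^ c x)%N : int).
Proof.
move=> cI x y x' y' xy e.
have {}xy : c x <> c y by move/cI.
have {}e : (3 ^ c x + 3 ^ c y' = 3 ^ c x' + 3 ^ c y)%N by lia.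
suff [/cI -> /cI ->] : c x = c x' /\ c y = c y' by [].
have [xy'|y'x] := leqP (c x) (c y'); have [x'y|yx'] := leqP (c x') (c y).
- by have [-> ->] := pow3_sum_inj_sorted xy' x'y e.
- rewrite [in RHS]addnC in e.
  by have [/xy] := pow3_sum_inj_sorted xy' (ltnW yx') e.
- rewrite [in LHS]addnC in e.
  by have [_ /xy] := pow3_sum_inj_sorted (ltnW y'x) x'y e.
- rewrite addnC [in RHS]addnC in e.
  by have [-> ->] := pow3_sum_inj_sorted (ltnW y'x) (ltnW yx') e.
Qed.

(** Powers of 3 are odd, so their differences are even. *)
Lemma pow3_difference_neq1 (a b : nat) : ((3 ^ a)%N%:Z - (3 ^ b)%N%:Z <> 1)%R.
Proof.
move=> e; have := congr1 odd (_ : 3 ^ a = 1 + 3 ^ b)%N.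
by rewrite oddD !oddX /= !orbT => /(_ ltac:(lia)).
Qed.

(** * The two-generated subgroup of the wreath product *)

Section Embedding.
Variables (G : groupType) (u : G -> int).
Hypotheses (sidon_u : sidon u) (u_neq1 : forall x y, (u x - u y <> 1)%R).

Definition spread (k : int) : G :=
  if pselect (exists y, u y = k) is left h then projT1 (cid h) else 1.

Lemma sidon_inj : injective u.
Proof.
move=> x y uxy; apply: contrapT => xy.
have [|_ yx] := @sidon_u x y x x xy; first lia.
exact: xy.
Qed.

Lemma spread_u y : spread (u y) = y.
Proof.
rewrite /spread; case: pselect => [h|[]]; last by exists y.
by case: cid => z /= /sidon_inj.
Qed.

Lemma spread_out k : (forall y, k <> u y) -> spread k = 1.
Proof.
move=> kN; rewrite /spread; case: pselect => // h; exfalso.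
by case: h => y /esym /kN.
Qed.

Definition shifted_spread (x : G) (k : int) : G := spread (k + u x)%R.

Lemma shifted_spread0 x : shifted_spread x 0%R = x.
Proof. by rewrite /shifted_spread add0r spread_u. Qed.

Lemma shifted_spread1 x : shifted_spread x 1%R = 1.
Proof. by apply: spread_out => y e; apply: (@u_neq1 y x); lia. Qed.

Lemma shifted_spread_diff x y : shifted_spread x (u y - u x)%R = y.
Proof. by rewrite /shifted_spread subrK spread_u. Qed.

Lemma shifted_spread_out x k : (forall y, k <> (u y - u x)%R) ->
  shifted_spread x k = 1.
Proof. by move=> kN; apply: spread_out => y e; apply: (kN y); lia. Qed.

Lemma shifted_spread_other x y z : x <> y -> z <> y ->
  shifted_spread x (u z - u y)%R = 1.
Proof.
move=> xy zy; apply: shifted_spread_out => w.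
by move=> /(sidon_u zy)[_ /esym].
Qed.

Definition delta (z : G) (k : int) : G := if k == 0%R then z else 1.

(** By the Sidon property, 0 is the only place where both functions can be
    nontrivial. *)
Lemma commutator_shifted_spread x y : x <> y ->
  [~ base (shifted_spread x), base (shifted_spread y)] = base (delta [~ x, y]).
Proof.
move=> xy; apply: wreath_eq => [k|]; last exact: wreathR2.
rewrite wreathR1 //= /delta; case: eqP => [->|k0].
  by rewrite !shifted_spread0.
have [[z kz]|kN] := pselect (exists z, k = (u z - u y)%R); last first.
  rewrite [X in [~ _, X]]shifted_spread_out ?commg1 // => z kz.
  by apply: kN; exists z.
rewrite kz shifted_spread_other ?comm1g // => zy.
by apply: k0; rewrite kz zy subrr.
Qed.

Definition generators : set (wreath G) :=
  [set v | v = translation G 1%R \/ v = base spread].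

Local Notation two_generator_group := (subgroup_type (generated generators)).

Lemma two_generator_group_k_generated : k_generated two_generator_group 2.
Proof.
have gt : translation G 1%R \in generated generators.
  by apply: mem_generated; left.
have gf : base spread \in generated generators by apply: mem_generated; right.
pose t : two_generator_group := in_subgroup gt; pose f : two_generator_group := in_subgroup gf.
exists (fun i : 'I_2 => if i == ord0 then t else f) => x.
move: (generated_subgroup_type x) => /generatedP gx; apply/generatedP => S XS.
apply: gx => h [ht|hf]; apply: XS; [exists ord0|exists ord_max] => //.
  by apply: val_inj; rewrite ht.
by apply: val_inj; rewrite hf.
Qed.

Lemma translation_gen m : translation G m \in generated generators.
Proof.
elim/int_ind: m => [|n IHn|n IHn].
- exact: gpred1.
- by rewrite intS translationD gpredM //; apply: mem_generated; left.
by rewrite translationV gpredV intS translationD gpredM //;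
  [apply: mem_generated; left|rewrite -gpredV -translationV].
Qed.

Lemma shifted_spread_gen x : base (shifted_spread x) \in generated generators.
Proof.
rewrite /shifted_spread base_shift !gpredM ?translation_gen //.
by apply: mem_generated; right.
Qed.

(** The elements [z] for which this holds form a subgroup, which contains the
    commutators by [commutator_shifted_spread]. *)
Lemma delta_gen z : z \in derived 1 -> base (delta z) \in generated generators.
Proof.
move: z; apply: generated_min.
- rewrite (_ : base _ = 1) ?gpred1 //; apply: wreath_eq => // k.
  by rewrite /= /delta if_same.
- move=> x y xg yg; rewrite (_ : delta _ = fun k => delta x k * delta y k).
    by rewrite baseM gpredM.
  by apply/funext => k; rewrite /delta; case: ifP; rewrite // mulg1.
- move=> x xg; rewrite (_ : base _ = (base (delta x))^-1) ?gpredV //.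
  apply: wreath_eq => [k|]; last by rewrite wreathV2 oppr0.
  by rewrite wreathV1 /= subr0 /delta; case: ifP; rewrite // invg1.
move=> _ [x [y [_ _ ->]]]; have [->|xy] := pselect (x = y).
  rewrite commgg (_ : base _ = 1) ?gpred1 //; apply: wreath_eq => // k.
  by rewrite /= /delta if_same.
by rewrite -commutator_shifted_spread // gpredR ?shifted_spread_gen.
Qed.

(** A commutator with a translation multiplies the inverse of a function by its
    translate.  For the function with value [x^-1] at 0 and 1 at its neighbour,
    the value at 0 is [x]. *)
Lemma derived_two_generator_group_onto (x : G) :
  exists2 h : two_generator_group, h \in derived 1 & (val h).1 0%R = x.
Proof.
pose f : two_generator_group := in_subgroup (shifted_spread_gen x^-1).
pose t : two_generator_group := in_subgroup (translation_gen (-1)%R).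
exists [~ f, t]; first by apply: mem_generated; exists f, t.
rewrite gmulfR -[[~ _, _]]/[~ base (shifted_spread x^-1), translation G (-1)%R].
rewrite /commg /conjg !wreathM1 !wreathV1 /= ?wreathV2 /=.
rewrite !(oppr0, subr0, addr0, add0r, opprK, invg1, mulg1, mul1g).
by rewrite shifted_spread0 shifted_spread1 mulg1 invgK.
Qed.

Lemma two_generator_group_solvable l : solvable_of_length G l ->
  solvable_of_length two_generator_group l.+1.
Proof.
move=> Gl; apply: solvable_wreath Gl derived_two_generator_group_onto _.
exists (in_subgroup (translation_gen 1%R)) => /(congr1 val)/(congr1 snd).
by rewrite val_in_subgroup gmulf1.
Qed.

(** * Embedding the preimage of a free abelian subgroup *)

Section Coordinate.
Variable B : set (additive_abelianization G).
Hypothesis indB : independent B.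

Definition span_preimage : {pred G} := fun g => `[<span B (ab g)>].

Fact span_preimageM : mulg_closed span_preimage.
Proof. by move=> g h /asboolP gB /asboolP hB; apply/asboolP; rewrite abM; exact: spanD. Qed.
Fact span_preimage1 : 1 \in span_preimage.
Proof. by apply/asboolP; rewrite ab1; exact: span0. Qed.
Fact span_preimageV : invg_closed span_preimage.
Proof. by move=> g /asboolP gB; apply/asboolP; rewrite abV; exact: spanN. Qed.

HB.instance Definition _ := isMulClosed.Build G span_preimage span_preimageM.
HB.instance Definition _ := isMul1Closed.Build G span_preimage span_preimage1.
HB.instance Definition _ := isInvClosed.Build G span_preimage span_preimageV.

(** The coordinate of [g] along the class of [x], counted only for the chosen
    representative [x] of that class, so that one [x] answers for each [b] in
    [B]. *)
Definition lift_coord (g x : G) : int :=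
  if x == ab_repr (ab x) then coord B (ab g) (ab x) else 0%R.

(** For varying [k], the components of the embedding of [span_preimage] into
    the base group: the inclusion at 0, and a homomorphism into the cyclic
    subgroup generated by [y] at [u y - u x]. *)
Definition power_family (g : G) (k : int) : G :=
  if k == 0%R then g else
  if pselect (exists p : G * G, k = (u p.1 - u p.2)%R) is left h
  then let p := projT1 (cid h) in zexpg p.1 (lift_coord g p.2)
  else 1.

Lemma power_family0 g : power_family g 0%R = g.
Proof. by rewrite /power_family eqxx. Qed.

Lemma power_family_diff g x y : y <> x ->
  power_family g (u y - u x)%R = zexpg y (lift_coord g x).
Proof.
move=> yx; rewrite /power_family subr_eq0; case: eqP => [/sidon_inj //|_].
case: pselect => [h|[]]; last by exists (y, x).
by case: cid => -[y' x'] /= /(sidon_u yx)[-> ->].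
Qed.

Lemma power_family_out g k : k <> 0%R -> (forall x y, k <> (u y - u x)%R) ->
  power_family g k = 1.
Proof.
move=> /eqP/negPf k0 kN; rewrite /power_family k0; case: pselect => // h.
by exfalso; case: h => p /kN.
Qed.

Lemma position_cases k : [\/ k = 0%R, exists x y, y <> x /\ k = (u y - u x)%R
  | k <> 0%R /\ forall x y, k <> (u y - u x)%R].
Proof.
have [->|/eqP k0] := eqVneq k 0%R; first exact: Or31.
have [[x [y kxy]]|kN] := pselect (exists x y, k = (u y - u x)%R).
  apply: Or32; exists x, y; split=> // yx; apply: k0.
  by rewrite kxy yx subrr.
by apply: Or33; split=> // x y kxy; apply: kN; exists x, y.
Qed.

Lemma power_familyM g h k : g \in span_preimage -> h \in span_preimage ->
  power_family (g * h) k = power_family g k * power_family h k.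
Proof.
move=> /asboolP gB /asboolP hB.
case: (position_cases k) => [->|[x [y [yx ->]]]|[k0 kN]].
- by rewrite !power_family0.
- rewrite !power_family_diff // -zexpgD /lift_coord; congr zexpg.
  by rewrite abM coordD //; case: ifP; rewrite // addr0.
by rewrite !power_family_out // mulg1.
Qed.

(** At [u y - u x], both sides are [y] if [x] represents [b], and 1 otherwise. *)
Lemma power_family_basis b : B b ->
  power_family (ab_repr b) = shifted_spread (ab_repr b).
Proof.
move=> Bb; apply/funext => k.
case: (position_cases k) => [->|[x [y [yx ->]]]|[k0 kN]].
- by rewrite power_family0 shifted_spread0.
- rewrite power_family_diff // /lift_coord ab_reprK coord_mem //.
  have [->|xb] := eqVneq x (ab_repr b).
    by rewrite ab_reprK !eqxx /= expg1 shifted_spread_diff.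
  rewrite shifted_spread_other //; last by apply/eqP; rewrite eq_sym.
  by case: ifP => // /eqP xE; case: eqP => // xb'; rewrite xE xb' eqxx in xb.
by rewrite power_family_out // shifted_spread_out.
Qed.

(** All coordinates of an element of the derived subgroup vanish, which leaves
    only the value at 0. *)
Lemma power_family_derived z : z \in derived 1 -> power_family z = delta z.
Proof.
move=> /ab_eq0 z0; apply/funext => k.
case: (position_cases k) => [->|[x [y [yx ->]]]|[k0 kN]].
- by rewrite power_family0.
- rewrite power_family_diff // /lift_coord z0 coord0 // if_same /delta subr_eq0.
  by case: eqP => // /sidon_inj.
by rewrite power_family_out // /delta; case: eqP.
Qed.

(** Up to an element of the derived subgroup, covered by [delta_gen], [g] is a
    product of chosen representatives of elements of [B] and of their inverses,
    whose images are translates of [spread]. *)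
Lemma power_family_gen g : g \in span_preimage ->
  base (power_family g) \in generated generators.
Proof.
move=> /[dup] gK /asboolP Bg.
have [p [pa pK pg]] : exists p, [/\ ab p = ab g, p \in span_preimage &
    base (power_family p) \in generated generators].
  move: (ab g) Bg; apply: span_ind => [|a b|b Bb].
  - exists 1; split; rewrite ?gpred1 //.
    rewrite power_family_derived ?gpred1 //; apply: delta_gen; exact: gpred1.
  - move=> [p [<- pK pg]] [q [<- qK qg]]; exists (p / q).
    have pqK : p / q \in span_preimage by exact: gpredF.
    split; rewrite ?abF //.
    rewrite -(gpredMr _ qg) -baseM (_ : (fun _ => _) = power_family p) //.
    by apply/funext => k; rewrite -power_familyM // mulgVK.
  - exists (ab_repr b); split; first exact: ab_reprK.
      by apply/asboolP; rewrite ab_reprK; exact: mem_span.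
    by rewrite power_family_basis //; exact: shifted_spread_gen.
have zD : p^-1 * g \in derived 1 by apply/ab_eq0; rewrite abM abV pa addNr.
have zK : p^-1 * g \in span_preimage by rewrite gpredM ?gpredV.
rewrite (_ : power_family g = fun k => power_family p k * power_family (p^-1 * g) k).
  by rewrite baseM gpredM // power_family_derived // delta_gen.
by apply/funext => k; rewrite -power_familyM // mulVKg.
Qed.

Definition embedding (x : subgroup_type span_preimage) : two_generator_group :=
  in_subgroup (power_family_gen (valP x)).

Fact embeddingM : {morph embedding : x y / x * y}.
Proof.
move=> x y; apply: val_inj; rewrite gmulfM !val_in_subgroup -baseM; congr base.
by apply/funext => k; rewrite power_familyM; [|exact: valP..].
Qed.

Fact embedding1 : embedding 1 = 1.
Proof. by apply: (mulgI (embedding 1)); rewrite -embeddingM !mulg1. Qed.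

HB.instance Definition _ := isMultiplicative.Build _ _ embedding embeddingM.
HB.instance Definition _ := Multiplicative_isUMagmaMorphism.Build _ _ embedding embedding1.

Lemma embedding_inj : injective embedding.
Proof.
move=> x y /(congr1 val); rewrite !val_in_subgroup => /(congr1 fst)/(congr1 (@^~ 0%R)) /=.
by rewrite !power_family0 => /val_inj.
Qed.

End Coordinate.
End Embedding.

(** The laws and the derived length are measured on the ambient [G], while only
    the subgroup [L] is embedded: in the finite index case [L] may have smaller
    derived length than [G]. *)
Definition two_generator_envelope (G L : groupType) : Prop :=
  exists H : groupType,
  [/\ k_generated H 2, embeds L H,
      forall M, is_variety M -> M G -> product_variety M abelian_group H
    & forall l, solvable_of_length G l -> solvable_of_length H l.+1].

Theorem span_preimage_embeds (G : groupType)
    (B : set (additive_abelianization G)) :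
  countable [set: G] -> independent B ->
  two_generator_envelope G (subgroup_type (span_preimage B)).
Proof.
move=> /countable_injP[c cI] indB.
have {}cI : injective c by move=> x y; apply: cI; rewrite inE.
have su := sidon_pow3 cI; have u1 x y := @pow3_difference_neq1 (c x) (c y).
exists (subgroup_type (generated (generators (fun x => (3 ^ c x)%N : int)))); split.
- exact: two_generator_group_k_generated.
- by exists (embedding su indB); exact: embedding_inj.
- by move=> M MV MG; exact: wreath_product_variety.
- by move=> l; exact: two_generator_group_solvable.
Qed.

Corollary spanning_embeds (G : groupType)
    (B : set (additive_abelianization G)) :
  countable [set: G] -> independent B -> (forall a, span B a) ->
  two_generator_envelope G G.
Proof.
move=> cG indB spanB; have [H [H2 [f fI] HM Hl]] := span_preimage_embeds cG indB.
exists H; split=> //.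
have allK x : x \in span_preimage B by apply/asboolP.
pose j (x : G) : subgroup_type (span_preimage B) := in_subgroup (allK x).
have jF : {morph j : x y / x / y}.
  by move=> x y; apply: val_inj; rewrite gmulfF !val_in_subgroup.
pose jm : {multiplicative G -> subgroup_type (span_preimage B)} :=
  HB.pack j (isGroupMorphism.Build _ _ j jF).
exists (f \o jm); apply: inj_comp => // x y /(congr1 val).
by rewrite !val_in_subgroup.
Qed.

(** * The choice of the independent set *)

Lemma span_preimage_finite_index (G : groupType)
    (B : set (additive_abelianization G)) (F : seq (additive_abelianization G)) :
  (forall a, exists2 f, f \in F & span B (a - f)%R) ->
  finite_index (span_preimage B).
Proof.
move=> FB; apply: (@sub_finite_set _ _
  [set left_coset (span_preimage B) (ab_repr f) | f in [set` F]]).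
  move=> _ [x _ <-]; have [f fF xf] := FB (ab x); exists f => //.
  rewrite /left_coset eqEsubset; split=> _ [k kK <-].
    exists (x^-1 * ab_repr f * k); last by rewrite !mulgA mulgV mul1g.
    rewrite /= gpredM //; apply/asboolP; rewrite abM abV ab_reprK addrC -opprB.
    exact: spanN.
  exists ((ab_repr f)^-1 * x * k); last by rewrite !mulgA mulgV mul1g.
  by rewrite /= gpredM //; apply/asboolP; rewrite abM abV ab_reprK addrC.
exact/finite_image/finite_seq.
Qed.

Lemma free_abelianization_embeds (G : groupType) : countable [set: G] ->
  free_abelian (abelianization G) -> two_generator_envelope G G.
Proof.
move=> cG [_ [B Bbasis]].
have [indB spanB] := abelian_basis_additive (@abelianization_abelian G) Bbasis.
exact: spanning_embeds cG indB spanB.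
Qed.

Lemma torsion_free_abelianization_embeds (G : groupType) : finitely_generated G ->
  torsion_free (abelianization G) -> two_generator_envelope G G.
Proof.
move=> fgG tfG; have [k [g gG]] := fgG.
have tfA : torsion_free_zmod (additive_abelianization G).
  by move=> a n n0 an0; apply: (tfG a n n0); have := an0; rewrite -expg_additive.
have [B indB spanB] := torsion_free_span_basis [seq ab (g i) | i <- enum 'I_k] tfA.
apply: (spanning_embeds (fg_countable fgG) indB) => a.
apply: spanB; exact: (span_ab_generators gG).
Qed.

Lemma finite_index_embeds (G : groupType) : finitely_generated G ->
  exists K : groupClosed G, finite_index K /\ two_generator_envelope G (subgroup_type K).
Proof.
move=> fgG; have [k [g gG]] := fgG.
have [B [F [indB FB]]] := finite_span_quasi_free [seq ab (g i) | i <- enum 'I_k].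
exists (span_preimage B : groupClosed G); split.
  apply: (@span_preimage_finite_index _ _ F) => a.
  apply: FB; exact: (span_ab_generators gG).
exact: span_preimage_embeds (fg_countable fgG) indB.
Qed.

Local Close Scope group_scope.

Theorem corollary2 (M : group_class) (hM : is_variety M) :
  (* (1) *)
  ((forall G : groupType, M G -> countable [set: G] ->
      free_abelian (abelianization G) ->
      exists H : groupType,
        [/\ product_variety M abelian_group H, k_generated H 2 & embeds G H]) /\
   (forall G : groupType, M G -> finitely_generated G ->
      torsion_free (abelianization G) ->
      exists H : groupType,
        [/\ product_variety M abelian_group H, k_generated H 2 & embeds G H]))
  /\
  (* (2) *)
  ((forall (l : nat) (G : groupType), countable [set: G] ->
      solvable_of_length G l -> free_abelian (abelianization G) ->
      exists H : groupType,
        [/\ solvable_of_length H l.+1, k_generated H 2 & embeds G H]) /\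
   (forall (l : nat) (G : groupType), finitely_generated G ->
      solvable_of_length G l -> torsion_free (abelianization G) ->
      exists H : groupType,
        [/\ solvable_of_length H l.+1, k_generated H 2 & embeds G H]))
  /\
  (* (3) *)
  ((forall G : groupType, M G -> finitely_generated G ->
      exists K : groupClosed G, finite_index K /\
      exists H : groupType,
        [/\ product_variety M abelian_group H, k_generated H 2
          & embeds (subgroup_type K) H]) /\
   (forall (l : nat) (G : groupType), finitely_generated G ->
      solvable_of_length G l ->
      exists K : groupClosed G, finite_index K /\
      exists H : groupType,
        [/\ solvable_of_length H l.+1, k_generated H 2
          & embeds (subgroup_type K) H])).
Proof.
split; [split|split; split].
- by move=> G MG cG /(free_abelianization_embeds cG)[H [? ? HM _]]; exists H; split; auto.
- move=> G MG fgG /(torsion_free_abelianization_embeds fgG)[H [? ? HM _]].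
  by exists H; split; auto.
- move=> l G cG Gl /(free_abelianization_embeds cG)[H [? ? _ HS]].
  by exists H; split; auto.
- move=> l G fgG Gl /(torsion_free_abelianization_embeds fgG)[H [? ? _ HS]].
  by exists H; split; auto.
- move=> G MG /finite_index_embeds[K [finK [H [? ? HM _]]]].
  by exists K; split=> //; exists H; split; auto.
move=> l G /finite_index_embeds[K [finK [H [? ? _ HS]]]] Gl.
by exists K; split=> //; exists H; split; auto.
Qed.
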